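(* Let $\sigma,p>0$, and let $\mu$ and $\nu$ be two measure-valued solutions (on $[0,\infty)$) to $$\partial_t\mu+\partial_y(u(\mu)\mu)=0$$ with initial data $\mu_0,\nu_0$ both supported in $R_0=[y_{\min},y_{\max}]\times[\theta_{\min},\theta_{\max}]$, $y_{\min},\theta_{\min}>0$. Then for any $t>0$ one has $$\mathcal{W}_1(\mu_t,\nu_t)\le C e^{ct}\,\mathcal{W}_1(\mu_0,\nu_0),$$ where $C,c>0$ depend on the initial condition and the parameters of the model.
   Context: $\mathbb{R}_+=(0,\infty)$, $\Omega=\mathbb{R}_+\times\mathbb{R}_+$ with points $(y,\theta)$. $\mathcal{P}_0(\Omega)$ is the set of Borel probability measures on $\Omega$ with compact support contained in $\Omega$. The velocity is $$u(\mu_t)(y,\theta)=\int_\Omega (z-y)\,d\mu_t(z,\eta)+\sigma(\theta-y^p)y .$$ A measure-valued solution on $[0,T)$ with initial data $\mu_0$ is a weakly* continuous map $t\mapsto\mu_t\in\mathcal{P}_0(\Omega)$, $t\in[0,T)$, such that for all $\varphi\in C_0^\infty([0,T)\times\Omega)$ and $0<t<T$, $$\int_\Omega\varphi(t,y,\theta)\,d\mu_t=\int_\Omega\varphi(0,y,\theta)\,d\mu_0+\int_0^t\int_\Omega[\partial_s\varphi+u(\mu_s)\,\partial_y\varphi]\,d\mu_s\,ds ;$$ a solution on $[0,\infty)$ is one on $[0,T)$ for every $T>0$. Measure-valued solutions are understood to be transported (push-forward of the initial measure) along the characteristics $$\frac{d}{dt}Y(t,y,\theta)=\int_\Omega\big(Y(t,y',\theta')-Y(t,y,\theta)\big)\,d\mu_0(y',\theta')+\sigma\,Y(t,y,\theta)\big(\theta-Y(t,y,\theta)^p\big),\quad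 Y(0,y,\theta)=y,$$ with $\theta$ constant in time. $\mathcal{W}_1$ is the Wasserstein-1 distance, $\mathcal{W}_1(\mu,\nu)=\sup\{|\int\varphi\,d\mu-\int\varphi\,d\nu|:\ \mathrm{Lip}(\varphi)\le1\}$. The parameters of the model are $\sigma,p$. *)

(* Defs.v *)
From HB Require Import structures.
From mathcomp Require Import all_boot all_order all_algebra.
From mathcomp Require Import all_classical all_reals all_analysis.
Import Order.TTheory GRing.Theory Num.Theory.
Import numFieldNormedType.Exports.

Set Implicit Arguments.
Unset Strict Implicit.
Unset Printing Implicit Defensive.

Local Open Scope classical_set_scope.
Local Open Scope ring_scope.

Section Defs.
Context {R : realType}.

Definition Omega : set (R * R) := [set x | 0 < x.1 /\ 0 < x.2].

Definition rectangle (ymin ymax thmin thmax : R) : set (R * R) :=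
  [set x | (ymin <= x.1 <= ymax) /\ (thmin <= x.2 <= thmax)].

(* Probability measures on Omega are represented by probability measures on
   the Borel plane R * R whose topological support lies in Omega. *)
Definition planeProb := probability (R * R)%type R.

Definition msupport (m : planeProb) : set (R * R) :=
  [set x | forall U : set (R * R), open U -> U x -> (0 < m U)%E].

Definition P0 (m : planeProb) : Prop :=
  compact (msupport m) /\ msupport m `<=` Omega.

(* The norm of the normed module R * R is the maximum norm, hence this explicit
   Euclidean distance. *)
Definition edist (x z : R * R) : R :=
  Num.sqrt ((x.1 - z.1) ^+ 2 + (x.2 - z.2) ^+ 2).

Definition lip1 (f : R * R -> R) : Prop :=
  forall x z, Omega x -> Omega z -> `|f x - f z| <= edist x z.

Definition W1 (m n : planeProb) : \bar R :=
  ereal_sup [set (`|\int[m]_(x in Omega) f x - \int[n]_(x in Omega) f x|)%:E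
            | f in [set f | lip1 f]].

Definition velocity (sigma p : R) (m : planeProb) (y theta : R) : R :=
  \int[m]_(z in Omega) (z.1 - y) + sigma * (theta - y `^ p) * y.

(* The space C_0(Omega), whose dual is the space of finite Radon measures. *)
Definition C0 (f : R * R -> R) : Prop :=
  {within Omega, continuous f} /\
  forall e : R, 0 < e -> exists K : set (R * R),
    [/\ compact K, K `<=` Omega & forall x, Omega x -> ~ K x -> `|f x| < e].

Definition weakstar_continuous (T : R) (mu : R -> planeProb) : Prop :=
  forall f, C0 f ->
    {within `[0, T[, continuous (fun t => \int[mu t]_(x in Omega) f x)}.

(* Points of R * R * R are triples ((t, y), theta). *)
Definition e_t : R * R * R := (1, 0, 0).
Definition e_y : R * R * R := (0, 1, 0).
Definition e_theta : R * R * R := (0, 0, 1).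

Fixpoint Ck (k : nat) (f : R * R * R -> R) : Prop :=
  continuous f /\
  if k is k'.+1 then
    forall v, v \in [:: e_t; e_y; e_theta] ->
      (forall x, derivable f x v) /\ Ck k' (fun x => 'D_v f x)
  else True.

(* Elements of C_0^oo([0, T) x Omega) are the restrictions to [0, T) x Omega of
   these functions; they need not vanish at t = 0. *)
Definition test_function (T : R) (phi : R * R * R -> R) : Prop :=
  [/\ forall k, Ck k phi,
      compact (closure [set x | phi x != 0]) &
      closure [set x | phi x != 0] `<=`
        [set x | x.1.1 < T /\ Omega (x.1.2, x.2)]].

Definition weak_formulation (sigma p T : R) (mu0 : planeProb)
    (mu : R -> planeProb) : Prop :=
  forall (phi : R * R * R -> R) (t : R), test_function T phi -> 0 < t < T ->
    \int[mu t]_(x in Omega) phi (t, x.1, x.2) =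
    \int[mu0]_(x in Omega) phi (0, x.1, x.2) +
    \int[lebesgue_measure]_(s in `[0, t])
      \int[mu s]_(x in Omega)
        ('D_e_t phi (s, x.1, x.2) +
         velocity sigma p (mu s) x.1 x.2 * 'D_e_y phi (s, x.1, x.2)).

Definition characteristics (sigma p T : R) (mu0 : planeProb)
    (Y : R -> R -> R -> R) : Prop :=
  forall y theta, Omega (y, theta) ->
    [/\ Y 0 y theta = y,
        forall t, 0 <= t < T -> 0 < Y t y theta,
        {within `[0, T[, continuous (fun t => Y t y theta)} &
        forall t, 0 < t < T ->
          is_derive t (1 : R) (fun s => Y s y theta)
            (\int[mu0]_(x in Omega) (Y t x.1 x.2 - Y t y theta) +
             sigma * Y t y theta * (theta - Y t y theta `^ p))].

(* mu t is the push-forward of mu0 by the map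
   (y, theta) |-> (Y t y theta, theta), which is only relevant on Omega. *)
Definition transported (T : R) (mu0 : planeProb) (mu : R -> planeProb)
    (Y : R -> R -> R -> R) : Prop :=
  forall t, 0 <= t < T ->
    measurable_fun Omega (fun x : R * R => Y t x.1 x.2) /\
    forall A : set (R * R), measurable A ->
      mu t A = mu0 (Omega `&` (fun x => (Y t x.1 x.2, x.2)) @^-1` A).

Definition mv_solution (sigma p T : R) (mu0 : planeProb)
    (mu : R -> planeProb) : Prop :=
  [/\ forall t, 0 <= t < T -> P0 (mu t),
      weakstar_continuous T mu,
      weak_formulation sigma p T mu0 mu &
      exists2 Y, characteristics sigma p T mu0 Y & transported T mu0 mu Y].

Definition global_mv_solution (sigma p : R) (mu0 : planeProb)
    (mu : R -> planeProb) : Prop :=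
  forall T, 0 < T -> mv_solution sigma p T mu0 mu.

End Defs.

(* Main.v *)
Require Import Defs.
From mathcomp Require Import all_boot all_order all_algebra.
From mathcomp Require Import all_classical all_reals all_analysis.
From mathcomp Require Import measurable_realfun ring lra.
Import Order.TTheory GRing.Theory Num.Theory.
Import numFieldNormedType.Exports.

(* Write mu_t and nu_t as the push-forwards of mu_0 and nu_0 by the flows X and
   Z.  The difference of two characteristics of the same flow obeys an equation
   in which the mean cancels, and u |-> u^(p+1) is increasing, so X is monotone
   in (y, theta); hence the characteristic starting at the upper right corner of
   the rectangle dominates the mean, and it stays below some K.  The same
   cancellation then shows that x |-> X(s, x) is e^(b s)-Lipschitz on the
   rectangle, with b = sigma theta_max + sigma K.  Finally, if |X - Z| is at most
   A e^(c s) on the rectangle, c = b + 2, then the means differ by at most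
   e^(b s) W_1(mu_0, nu_0) + A e^(c s), and integrating the equation for X - Z
   improves A to (W_1(mu_0, nu_0) + A) / 2; so the best A is at most
   W_1(mu_0, nu_0).  Testing with f and splitting
   f(X) mu_0 - f(Z) nu_0 = f(X) (mu_0 - nu_0) + (f(X) - f(Z)) nu_0
   concludes. *)

Set Implicit Arguments.
Unset Strict Implicit.
Unset Printing Implicit Defensive.
Local Open Scope classical_set_scope.
Local Open Scope ring_scope.

(** * Open sets of the plane, and null sets off the support *)

(** A countable base of the plane, indexed by [nat] through the coding of rational triples, so that
    covers by boxes are countable unions. It relates the topology to the product sigma-algebra; a
    number that codes no triple gives the empty set. *)
Definition rat_box (R : realType) (n : nat) : set (R * R) :=
  if @pickle_inv (rat * rat * rat)%type n is Some (a, b, r) then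
    ball (ratr a : R) (ratr r) `*` ball (ratr b : R) (ratr r)
  else set0.

Lemma measurable_rat_box (R : realType) (n : nat) : measurable (@rat_box R n).
Proof.
rewrite /rat_box; case: pickle_inv => [[[a b] r]|]; last exact: measurable0.
by apply: measurableX; apply: open_measurable; exact: ball_open.
Qed.

Lemma rat_box_basis (R : realType) (U : set (R * R)) (x : R * R) :
  open U -> U x -> exists2 n, @rat_box R n x & rat_box n `<=` U.
Proof.
move=> oU Ux; have /nbhs_ballP[e /= e0 eU] : nbhs x U by apply: open_nbhs_nbhs.
(* With radius below [e / 2], every box of that radius containing [x] lies in the ball of radius [e]
   about [x]. *)
have [r /[!in_itv]/= /andP[r0 re]] :
  exists r : rat, ratr r \in `]0, (e / 2)[%R by apply: rat_in_itvoo; lra.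
have ratc (z : R) : exists a : rat, `|ratr a - z| < ratr r.
  have [a /[!in_itv]/= /andP[a1 a2]] :
    exists a : rat, ratr a \in `]z - ratr r, (z + ratr r)[%R.
    by apply: rat_in_itvoo; lra.
  by exists a; rewrite ltr_distl a1 a2.
have [a ax] := ratc x.1; have [b bx] := ratc x.2.
exists (pickle (a, b, r)); rewrite /rat_box pickleK_inv; first by split.
move=> z /= [az bz]; apply: eU.
rewrite /ball /= in az bz *; split; rewrite /ball /= ltr_distl.
  move: ax az; rewrite !ltr_distl; lra.
move: bx bz; rewrite !ltr_distl; lra.
Qed.

Lemma open_bigcup_rat_box (R : realType) (U : set (R * R)) : open U ->
  U = \bigcup_(n in [set n | rat_box n `<=` U]) rat_box n.
Proof.
move=> oU; apply/seteqP; split => x; last by move=> [n /= nU]; exact: nU.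
by move=> /(rat_box_basis oU)[n nx nU]; exists n.
Qed.

Lemma open_measurable_plane (R : realType) (U : set (R * R)) :
  open U -> measurable U.
Proof.
move=> /open_bigcup_rat_box ->.
by apply: bigcup_measurable => n _; exact: measurable_rat_box.
Qed.

Lemma measurable_Omega (R : realType) : measurable (@Omega R).
Proof.
rewrite (_ : Omega = `]0, +oo[ `*` `]0, +oo[); first exact: measurableX.
by apply/seteqP; split => x /=; rewrite /Omega /= !in_itv /= !andbT.
Qed.

(** A Lindelöf argument: each point off [C] has a null neighbourhood, hence a null rational box
    inside the complement of [C], and there are only countably many such boxes. *)
Lemma negligible_setC_msupport (R : realType) (m : @planeProb R)
    (C : set (R * R)) : closed C -> msupport m `<=` C -> m (~` C) = 0%E.
Proof.
move=> cC suppC; have oC : open (~` C) by exact: closed_openC.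
have mC := open_measurable_plane oC.
have null x : (~` C) x ->
    exists2 n, @rat_box R n x & rat_box n `<=` ~` C /\ m (rat_box n) = 0%E.
  move=> Cx; have : ~ msupport m x by move/suppC.
  move=> /existsNP[U] /not_implyP[oU] /not_implyP[Ux /negP].
  rewrite -leNgt => mU0.
  have [n nx nUC] := rat_box_basis (openI oU oC) (conj Ux Cx).
  exists n => //; split; first by move=> y /nUC[].
  apply/eqP; rewrite eq_le measure_ge0 andbT; apply: le_trans mU0.
  apply: le_measure; rewrite ?inE //; first exact: measurable_rat_box.
    exact: open_measurable_plane.
  by move=> y /nUC[].
pose F n : set (R * R) :=
  if `[< m (rat_box n) = 0%E >] then rat_box n else set0.
have subF : ~` C `<=` \bigcup_n F n.
  by move=> x /null[n nx [_ n0]]; exists n => //; rewrite /F asboolT.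
apply/(negligibleP m mC)/(negligibleS subF).
apply: negligible_bigcup => n; rewrite /F; case: asboolP => [n0|_].
  by exists (rat_box n); split => //; exact: measurable_rat_box.
exact: negligible_set0.
Qed.

Lemma closed_rectangle (R : realType) (ymin ymax thmin thmax : R) :
  closed (rectangle ymin ymax thmin thmax).
Proof.
rewrite (_ : rectangle _ _ _ _ =
    (fst @^-1` `[ymin, ymax]) `&` (snd @^-1` `[thmin, thmax])).
  apply: closedI; apply: preimage_closed; do ?exact: itv_closed.
    by move=> x _; exact: cvg_fst.
  by move=> x _; exact: cvg_snd.
by apply/seteqP; split => x /=; rewrite /rectangle /= !in_itv.
Qed.

(** * Integrals against a measure concentrated on a set *)

Section concentrated.
Context d (T : measurableType d) (R : realType).
Variables (m : probability T R) (D S : set T).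
Hypotheses (mD : measurable D) (mS : measurable S) (mS0 : m (~` S) = 0%E).

Lemma eq_Rintegral_concentrated (f g : T -> R) :
  measurable_fun D f -> measurable_fun D g ->
  (forall x, D x -> S x -> f x = g x) ->
  \int[m]_(x in D) f x = \int[m]_(x in D) g x.
Proof.
move=> mf mg fg; congr fine; apply: ae_eq_integral => //.
- exact/measurable_EFinP.
- exact/measurable_EFinP.
- exists (~` S); split => //; first exact: measurableC.
  move=> x /= /not_implyP[Dx fgx] Sx; apply: fgx.
  by rewrite fg.
Qed.

(** For integrals over [Omega] of functions controlled only on the rectangle: the complement of [S]
    is null and is cut out of the domain, after which the integrand is bounded. *)
Lemma bounded_integrable_concentrated (f : T -> R) (B : R) :
  measurable_fun D f -> (forall x, D x -> S x -> `|f x| <= B) ->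
  m.-integrable D (EFin \o f).
Proof.
move=> mf fB; have mSC := measurableC mS.
apply/(negligible_integrable mSC mD) => //; first exact/measurable_EFinP.
have mDS : measurable (D `\` ~` S) by exact: measurableD.
apply: measurable_bounded_integrable => //.
- exact: le_lt_trans (probability_le1 m mDS) (ltry _).
- exact: measurable_funS mf.
- exists B; split; first exact: num_real.
  move=> r Br x /= [Dx /contrapT Sx].
  exact: le_trans (fB x Dx Sx) (ltW Br).
Qed.

Lemma normr_Rintegral_le_concentrated (f : T -> R) (B : R) :
  measurable_fun D f -> 0 <= B -> (forall x, D x -> S x -> `|f x| <= B) ->
  `|\int[m]_(x in D) f x| <= B.
Proof.
move=> mf B0 fB; have intf := bounded_integrable_concentrated mf fB.
have mSC := measurableC mS.
rewrite /Rintegral (negligible_integral mSC mD intf mS0).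
have mDS : measurable (D `\` ~` S) by exact: measurableD.
have intDS : m.-integrable (D `\` ~` S) (EFin \o f).
  by apply: (integrableS mD) => //; exact: subDsetl.
apply: le_trans (le_normr_Rintegral mDS intDS) _.
apply: (@le_trans _ _ (\int[m]_(x in D `\` ~` S) B)).
  apply: le_Rintegral => //.
  - exact: (integrable_norm intDS).
  - exact: finite_measure_integrable_cst.
  - by move=> x [Dx /contrapT Sx]; exact: fB.
rewrite Rintegral_cst //; apply: ler_piMr => //.
rewrite -lee_fin fineK; first exact: probability_le1.
exact: fin_num_measure.
Qed.

End concentrated.

Lemma probability_concentrated d (T : measurableType d) (R : realType)
    (m : probability T R) (S : set T) :
  measurable S -> m (~` S) = 0%E -> m S = 1%E.
Proof.
move=> mS mS0; rewrite -(@probability_setT _ _ _ m) -(setUv S).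
rewrite measureU ?setICr //; last exact: measurableC.
by rewrite [X in (_ = _ + X)%E](_ : _ = 0%E) ?adde0.
Qed.

(** * Change of variables along the flow *)

(** A total measurable map that agrees with the transport map on [Omega]. The default value 0 of the
    restriction sends points outside [Omega] to points with first coordinate 0, again outside
    [Omega]; this is what [restrict_shear] uses. *)
Definition shear (R : realType) (g : R * R -> R) (x : R * R) : R * R :=
  ((g \_ Omega) x, x.2).

Lemma measurable_shear (R : realType) (g : R * R -> R) :
  measurable_fun Omega g -> measurable_fun setT (shear g).
Proof.
move=> mg; apply: measurable_fun_pair; last exact: measurable_snd.
exact/(measurable_restrictT _ (@measurable_Omega R)).
Qed.

Lemma restrict_shear (R : realType) (g f : R * R -> R) :
  (forall x, Omega x -> 0 < g x) ->
  (f \_ Omega) \o shear g = (fun x => f (g x, x.2)) \_ Omega.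
Proof.
move=> g0; apply/funext => x; rewrite /= /shear /patch.
case: (boolP (x \in Omega)) => xO; last first.
  by rewrite ifF //; apply/negbTE/negP; rewrite inE => -[] /=; rewrite ltxx.
rewrite ifT//; move: xO; rewrite !inE => xO.
by split; [exact: g0|case: xO].
Qed.

Lemma measurable_comp_shear (R : realType) (g f : R * R -> R) :
  (forall x, Omega x -> 0 < g x) ->
  measurable_fun Omega g -> measurable_fun Omega f ->
  measurable_fun Omega (fun x => f (g x, x.2)).
Proof.
move=> g0 mg mf; apply/(measurable_restrictT _ (@measurable_Omega R)).
rewrite -restrict_shear //; apply: measurableT_comp.
  exact/(measurable_restrictT _ (@measurable_Omega R)).
exact: measurable_shear.
Qed.

(** [transported] speaks of preimages within [Omega] only. Since the complement of [Omega] is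
    [mu0]-null, [mu t] is also the push-forward by the total map [shear], and the change of
    variables formula applies. *)
Lemma Rintegral_transported (R : realType) (T t : R) (mu0 : @planeProb R)
    (mu : R -> @planeProb R) (Y : R -> R -> R -> R) (f : R * R -> R) :
  mu0 (~` Omega) = 0%E -> transported T mu0 mu Y -> 0 <= t < T ->
  (forall x, Omega x -> 0 < Y t x.1 x.2) ->
  measurable_fun Omega f ->
  mu0.-integrable Omega (fun x => (f (Y t x.1 x.2, x.2))%:E) ->
  \int[mu t]_(x in Omega) f x = \int[mu0]_(x in Omega) f (Y t x.1 x.2, x.2).
Proof.
move=> Om0 /[apply] -[mY mut] Y0 mf intf.
have mO := @measurable_Omega R; have mOC := measurableC mO.
pose g (x : R * R) := Y t x.1 x.2; pose phi := shear g.
have mphi : measurable_fun setT phi by exact: measurable_shear.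
have mfO : measurable_fun setT (EFin \o (f \_ Omega)).
  by apply/measurable_EFinP; exact/(measurable_restrictT _ mO).
have phiE := restrict_shear f Y0.
have mupush A : measurable A -> A `<=` setT -> mu t A = pushforward mu0 phi A.
  move=> mA _; rewrite mut // /pushforward.
  have mB : measurable (phi @^-1` A).
    by rewrite -[X in measurable X]setTI; exact: mphi.
  rewrite (measureDI mu0 mB mO) [X in (_ = X + _)%E](_ : _ = 0%E) ?add0e.
    congr (mu0 _); apply/seteqP; split => x /= [].
      by move=> xO xA; rewrite /phi /shear /patch mem_set.
    by rewrite /phi /shear /patch => + xO; rewrite mem_set.
  apply/eqP; rewrite -measure_le0 -Om0; apply: le_measure; rewrite ?inE //.
    exact: measurableD.
rewrite Rintegral_mkcond [RHS]Rintegral_mkcond; congr fine.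
rewrite (eq_measure_integral (pushforward mu0 phi) mupush).
rewrite integral_pushforward //= ?preimage_setT.
  by rewrite -phiE.
rewrite -compA phiE -restrict_EFin; exact/(integrable_mkcond _ mO).
Qed.

(** * Euclidean distance and Lipschitz test functions *)

(* Unqualified, edist is the extended distance of MathComp-Analysis. *)
Lemma plane_edist_le_ball (R : realType) (x z : R * R) (e : R) :
  ball x e z -> Defs.edist x z <= 2 * e.
Proof.
move=> [] /=; rewrite /ball /= => x1 x2; rewrite /Defs.edist.
have e0 : 0 < e by exact: le_lt_trans x1.
rewrite -(@ger0_norm _ (2 * e)); last lra.
rewrite -sqrtr_sqr ler_wsqrtr // -(real_normK (num_real (x.1 - z.1))).
rewrite -(real_normK (num_real (x.2 - z.2))).
have := normr_ge0 (x.1 - z.1); have := normr_ge0 (x.2 - z.2).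
nra.
Qed.

Lemma lip1_measurable (R : realType) (f : R * R -> R) :
  lip1 f -> measurable_fun Omega f.
Proof.
move=> lipf; apply: (measurability _ (RGenOInfty.measurableE R)).
move=> _ [_ [a ->] <-]; apply: open_measurable_plane.
rewrite openE => x [[x1 x2]] /=; rewrite in_itv /= andbT => afx.
rewrite /interior; apply/nbhs_ballP.
(* The first two bounds keep the ball inside [Omega]. The third makes [f] drop by at most half of
   [f x - a], the Euclidean distance being at most [2 * e] on the ball. *)
pose e := Num.min (Num.min x.1 x.2) ((f x - a) / 4).
have e0 : 0 < e by rewrite !lt_min x1 x2 /=; lra.
exists e => //= z xz.
have ex1 : e <= x.1 by rewrite /e !ge_min lexx.
have ex2 : e <= x.2 by rewrite /e !ge_min lexx orbT.
have exa : e <= (f x - a) / 4 by rewrite /e ge_min lexx orbT.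
have Oz : Omega z.
  by case: xz; rewrite /ball /= !ltr_distl => /andP[? ?] /andP[? ?]; split; lra.
split=> //=; rewrite in_itv /= andbT.
have := lipf x z (conj x1 x2) Oz.
have := plane_edist_le_ball xz; rewrite ler_distl; lra.
Qed.

Lemma normr_fst_le_edist (R : realType) (x z : R * R) :
  `|x.1 - z.1| <= Defs.edist x z.
Proof. by rewrite /Defs.edist -sqrtr_sqr ler_wsqrtr // lerDl sqr_ge0. Qed.

Lemma normr_snd_le_edist (R : realType) (x z : R * R) :
  `|x.2 - z.2| <= Defs.edist x z.
Proof. by rewrite /Defs.edist -sqrtr_sqr ler_wsqrtr // lerDr sqr_ge0. Qed.

Lemma plane_edist_le_normr (R : realType) (x z : R * R) :
  Defs.edist x z <= `|x.1 - z.1| + `|x.2 - z.2|.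
Proof.
rewrite /Defs.edist -(@ger0_norm _ (`|x.1 - z.1| + `|x.2 - z.2|)) ?addr_ge0 //.
rewrite -sqrtr_sqr ler_wsqrtr // -(real_normK (num_real (x.1 - z.1))).
rewrite -(real_normK (num_real (x.2 - z.2))).
have := normr_ge0 (x.1 - z.1); have := normr_ge0 (x.2 - z.2).
nra.
Qed.

Lemma plane_edist_ge0 (R : realType) (x z : R * R) : 0 <= Defs.edist x z.
Proof. exact: sqrtr_ge0. Qed.

Lemma rectangle_Omega (R : realType) (ymin ymax thmin thmax : R) :
  0 < ymin -> 0 < thmin -> rectangle ymin ymax thmin thmax `<=` Omega.
Proof. by move=> ? ? x [/andP[? ?] /andP[? ?]]; split; lra. Qed.

(** * Projection onto the rectangle *)

Definition clamp (R : realType) (lo hi y : R) := Num.max lo (Num.min hi y).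

Lemma clamp_id (R : realType) (lo hi y : R) :
  lo <= y <= hi -> clamp lo hi y = y.
Proof. by case/andP=> ? ?; rewrite /clamp min_r // max_r. Qed.

Lemma clamp_in (R : realType) (lo hi y : R) :
  lo <= hi -> lo <= clamp lo hi y <= hi.
Proof. by move=> lh; rewrite /clamp le_max lexx ge_max lh ge_min lexx. Qed.

Lemma clamp_lip (R : realType) (lo hi y z : R) :
  `|clamp lo hi y - clamp lo hi z| <= `|y - z|.
Proof.
rewrite /clamp.
case: (leP hi y) => ?; case: (leP hi z) => ?; case: (leP lo hi) => ?;
  case: (leP lo y) => ?; case: (leP lo z) => ?; rewrite ler_norml;
  case: (ger0P (y - z)) => ?; apply/andP; split; lra.
Qed.

(** The nearest-point projection onto the rectangle. It is 1-Lipschitz, so composing with it extends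
    a function that is Lipschitz on the rectangle with the same constant. *)
Definition clamp_rect (R : realType) (ymin ymax thmin thmax : R) (x : R * R) :=
  (clamp ymin ymax x.1, clamp thmin thmax x.2).

Lemma edist_clamp_rect (R : realType) (ymin ymax thmin thmax : R) (x z : R * R) :
  Defs.edist (clamp_rect ymin ymax thmin thmax x)
    (clamp_rect ymin ymax thmin thmax z) <= Defs.edist x z.
Proof.
rewrite /Defs.edist ler_wsqrtr //; apply: lerD.
  by rewrite -[leLHS]real_normK ?num_real // -[leRHS]real_normK ?num_real //
     lerXn2r ?nnegrE // clamp_lip.
by rewrite -[leLHS]real_normK ?num_real // -[leRHS]real_normK ?num_real //
   lerXn2r ?nnegrE // clamp_lip.
Qed.

Section rectangle_measures.
Variables (R : realType) (ymin ymax thmin thmax : R).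
Hypotheses (ymin_gt0 : 0 < ymin) (thmin_gt0 : 0 < thmin).
Hypotheses (ymin_le : ymin <= ymax) (thmin_le : thmin <= thmax).
Local Notation R0 := (rectangle ymin ymax thmin thmax).

Lemma measurable_rectangle : measurable R0.
Proof.
rewrite -[R0]setCK; apply: measurableC; apply: open_measurable_plane.
apply: closed_openC; exact: closed_rectangle.
Qed.

Lemma lipschitz_Rintegral_diff (m n : @planeProb R) (g : R * R -> R) (L W : R) :
  m (~` R0) = 0%E -> n (~` R0) = 0%E ->
  (forall f, lip1 f ->
     `|\int[m]_(x in Omega) f x - \int[n]_(x in Omega) f x| <= W) ->
  measurable_fun Omega g -> 0 < L ->
  (forall x z, R0 x -> R0 z -> `|g x - g z| <= L * Defs.edist x z) ->
  `|\int[m]_(x in Omega) g x - \int[n]_(x in Omega) g x| <= L * W.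
Proof.
move=> m0 n0 mnW mg L0 lipg.
(* g is Lipschitz only on the rectangle, while W1 tests on all of Omega. *)
pose cl := clamp_rect ymin ymax thmin thmax.
have clR0 x : R0 (cl x) by split; exact: clamp_in.
have R0O : R0 `<=` Omega by exact: rectangle_Omega.
have clE x : R0 x -> cl x = x.
  by case: x => x1 x2 [/= h1 h2]; rewrite /cl /clamp_rect /= !clamp_id.
pose f x := L^-1 * g (cl x).
have lipf : lip1 f.
  move=> x z _ _; rewrite /f -mulrBr normrM gtr0_norm ?invr_gt0 //.
  rewrite ler_pdivrMl //; apply: le_trans (lipg _ _ (clR0 x) (clR0 z)) _.
  by rewrite ler_pM2l // edist_clamp_rect.
have gE x : Omega x -> R0 x -> L * f x = g x.
  by move=> _ xR0; rewrite /f mulVKf ?gt_eqF // clE.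
have mO := @measurable_Omega R; have mR0 := measurable_rectangle.
have mf := lip1_measurable lipf.
have mLf : measurable_fun Omega (fun x => L * f x).
  by apply: measurable_funM => //; exact: measurable_cst.
have fB x : Omega x -> R0 x -> `|f x| <= `|f (ymin, thmin)| +
    (`|ymax - ymin| + `|thmax - thmin|).
  move=> Ox [/andP[x1 x2] /andP[x3 x4]].
  have h : `|f x - f (ymin, thmin)| <= `|ymax - ymin| + `|thmax - thmin|.
    apply: le_trans (lipf _ _ Ox _) _; first by split.
    apply: le_trans (plane_edist_le_normr _ _) _ => /=.
    by apply: lerD; rewrite !ger0_norm; lra.
  rewrite -[f x in leLHS](subrK (f (ymin, thmin))).
  apply: le_trans (ler_normD _ _) _; lra.
have intE (k : @planeProb R) : k (~` R0) = 0%E ->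
    \int[k]_(x in Omega) g x = L * \int[k]_(x in Omega) f x.
  move=> k0; rewrite -(eq_Rintegral_concentrated mO mR0 k0 mLf mg gE).
  by rewrite RintegralZl //; exact: (bounded_integrable_concentrated mO mR0 k0 mf fB).
rewrite !intE // -mulrBr normrM gtr0_norm // ler_pM2l //.
exact: mnW.
Qed.

End rectangle_measures.

(** * Integrability of the flow *)

(* Without P0 (mu t) the integral in the characteristics could be infinite, and
   its real-valued version would be the junk value 0. *)
Lemma transported_integrable (R : realType) (T t : R) (mu0 : @planeProb R)
    (mu : R -> @planeProb R) (Y : R -> R -> R -> R) :
  mu0 (~` Omega) = 0%E -> transported T mu0 mu Y -> 0 <= t < T ->
  P0 (mu t) -> mu0.-integrable Omega (fun x => (Y t x.1 x.2)%:E).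
Proof.
move=> Om0 /[apply] -[mY mut] [/compact_bounded[M [_ Mb]] _].
pose B := `|M| + 1.
pose C := [set x : R * R | `|x.1| <= B].
have MB : M < B by rewrite /B; have := ler_norm M; lra.
have cC : closed C.
  rewrite (_ : C = fst @^-1` ((@Num.norm _ R) @^-1` [set y | y <= B])) //.
  apply: preimage_closed; first by move=> x _; exact: cvg_fst.
  apply: preimage_closed; first by move=> x _; exact: norm_continuous.
  exact: closed_le.
have suppC : msupport (mu t) `<=` C.
  move=> x /(Mb B MB); rewrite /C /=; apply: le_trans.
  by rewrite prod_normE le_max lexx.
have mC : measurable (~` C) by apply: open_measurable_plane; exact: closed_openC.
have := negligible_setC_msupport cC suppC; rewrite mut //.
(* [N] consists of the points of [Omega] that the flow carries to [|y| > B]; it is null because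
   [mu t] is concentrated on [C]. *)
set N := (X in mu0 X = _) => N0.
have mO := @measurable_Omega R.
have mN : measurable N.
  rewrite /N (_ : _ `&` _ = Omega `&` (fun x => Y t x.1 x.2) @^-1` [set y | B < `|y|]).
    apply: mY => //; apply: open_measurable.
    rewrite (_ : [set _ | _] = (@Num.norm _ R) @^-1` [set y | B < y]) //.
    apply: open_comp; first by move=> x _; exact: norm_continuous.
    exact: open_gt.
  apply/seteqP; split => x /=; rewrite /C /=.
    by move=> [? /negP]; rewrite -ltNge.
  by move=> [? ?]; split=> //; apply/negP; rewrite -ltNge.
have mNC : measurable (~` N) by exact: measurableC.
apply: (@bounded_integrable_concentrated _ _ _ mu0 Omega (~` N) mO mNC _ _ B) => //.
  by rewrite setCK.
move=> x Ox Nx; rewrite leNgt; apply/negP => BY; apply: Nx; split => //=.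
by rewrite /C /=; apply/negP; rewrite -ltNge.
Qed.

(** * Comparison principles for differential inequalities *)

Lemma barrier_le0 (R : realType) (w dw : R -> R) (t : R) : 0 <= t ->
  {within `[0, t], continuous w} ->
  (forall s, 0 < s < t -> is_derive s (1 : R) w (dw s)) ->
  w 0 <= 0 ->
  (forall s, 0 < s < t -> 0 < w s -> dw s <= 0) ->
  w t <= 0.
Proof.
move=> t0 cw dwP w0 dw_le0; rewrite leNgt; apply/negP => wt.
pose S := [set s | w s <= 0] `&` `[0, t].
(* Past the last point s0 of S, w is positive, hence nonincreasing. *)
have cS : compact S.
  have /closed_subspaceP[V cV VS] : @closed (subspace `[0, t]) 
      (w @^-1` [set y | y <= 0]).
    have /continuous_closedP := cw; apply; exact: closed_le.
  rewrite /S (_ : _ `&` _ = V `&` `[0, t]) //.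
  by rewrite setIC; apply: compact_closedI => //; exact: segment_compact.
have [s0 [ws0 /=]] : exists2 s0, S s0 & forall s, S s -> s <= s0.
  have [||s0 Ss0 smax] := @compact_EVT_max _ R id S _ cS.
  - by exists 0; split => //=; rewrite in_itv /= lexx t0.
  - by apply: continuous_subspaceT => x; exact: cvg_id.
  by exists s0; [rewrite inE in Ss0|move=> s Ss; apply: smax; rewrite inE].
rewrite in_itv /= => /andP[s00 s0t] smax.
have {}s0t : s0 < t.
  rewrite lt_neqAle s0t andbT; apply/eqP => s0E.
  by move: ws0 wt; rewrite /= s0E; lra.
have [||c] := @MVT _ w dw _ _ s0t.
- move=> s /[!in_itv]/= /andP[? ?]; apply: dwP; apply/andP; split; lra.
- apply: continuous_subspaceW cw => s /=; rewrite !in_itv /= => /andP[? ?].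
  by apply/andP; split; lra.
rewrite in_itv /= => /andP[s0c ct] wE.
have wc : 0 < w c.
  rewrite ltNge; apply/negP => wc.
  have : S c by split => //=; rewrite in_itv /=; apply/andP; split; lra.
  by move/smax; lra.
have := dw_le0 c _ wc; rewrite ct (le_lt_trans s00 s0c) => /(_ isT) dwc.
move: ws0 => /= ws0.
nra.
Qed.

(* The bound on dg is only required where g exceeds the barrier, so a can be any
   real; it says that exp (- a s) (g s - G exp (c s)) does not increase there. *)
Lemma exp_barrier (R : realType) (g dg : R -> R) (t a c G : R) : 0 <= t ->
  {within `[0, t], continuous g} ->
  (forall s, 0 < s < t -> is_derive s (1 : R) g (dg s)) ->
  g 0 <= G ->
  (forall s, 0 < s < t -> G * expR (c * s) < g s ->
     dg s <= a * g s + (c - a) * (G * expR (c * s))) ->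
  g t <= G * expR (c * t).
Proof.
move=> t0 cg dgP g0 dg_le.
pose w s := expR (- a * s) * (g s - G * expR (c * s)).
pose dw s := expR (- a * s) *
  (dg s - (a * g s + (c - a) * (G * expR (c * s)))).
suff : w t <= 0 by rewrite /w pmulr_rle0 ?expR_gt0 // subr_le0.
have cexp (k : R) : continuous (fun s : R => expR (k * s)).
  move=> s; apply: continuous_comp; last exact: continuous_expR.
  exact: mulrl_continuous.
apply: (@barrier_le0 _ w dw).
- exact: t0.
- have cE k : {within `[0, t], continuous (fun s => expR (k * s))}.
    exact: continuous_subspaceT (cexp k).
  have cG : {within `[0, t], continuous (cst G \* (fun s => expR (c * s)))}.
    move=> s; apply: (@continuousM R (subspace `[0, t])); last exact: cE.
    exact: cst_continuous.
  have cB : {within `[0, t], continuous (g - cst G \* (fun s => expR (c * s)))}.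
    by move=> s; apply: (@continuousB R R^o (subspace `[0, t])); [exact: cg|exact: cG].
  by move=> s; apply: (@continuousM R (subspace `[0, t]) _ _ _ (cE (- a) s) (cB s)).
- move=> s st; have dgs := dgP s st.
  rewrite /w /dw; apply: is_derive_eq.
  rewrite /GRing.scale /=; ring.
- by rewrite /w !mulr0 expR0 mul1r mulr1 subr_le0.
- move=> s st ws; rewrite /dw pmulr_rle0 ?expR_gt0 // subr_le0.
  apply: dg_le => //; move: ws; rewrite /w pmulr_rgt0 ?expR_gt0 // subr_gt0.
  exact.
Qed.

(** * The reaction term, flows and the Wasserstein bound *)

Definition reaction (R : realType) (sigma p theta u : R) : R :=
  sigma * u * (theta - u `^ p).

(** As [v <= u], the contribution of the powers, [- sigma (u^(p+1) - v^(p+1))], is nonpositive and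
    is dropped; then [th1 u - th2 v] splits as [th1 (u - v) + (th1 - th2) v]. Being one-sided, the
    bound involves no Lipschitz constant of the power. *)
Lemma reaction_diff_le (R : realType) (sigma p th1 th2 u v : R) :
  0 < sigma -> 0 < p -> 0 < v -> v <= u ->
  reaction sigma p th1 u - reaction sigma p th2 v
    <= sigma * th1 * (u - v) + sigma * (th1 - th2) * v.
Proof.
move=> s0 p0 v0 vu; rewrite /reaction.
have up : v `^ p <= u `^ p.
  by apply: ge0_ler_powR => //; rewrite ?nnegrE; lra.
have v1 : 0 <= v `^ p by exact: powR_ge0.
have : v * v `^ p <= u * u `^ p by apply: ler_pM => //; lra.
nra.
Qed.

Definition integrable_flow (R : realType) (sigma p T : R) (m : @planeProb R)
    (X : R -> R -> R -> R) : Prop :=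
  [/\ characteristics sigma p T m X,
      forall s, 0 <= s < T -> measurable_fun Omega (fun x => X s x.1 x.2) &
      forall s, 0 <= s < T ->
        m.-integrable Omega (fun x => (X s x.1 x.2)%:E)].

Definition flow_mean (R : realType) (m : @planeProb R) (X : R -> R -> R -> R)
    (s : R) : R :=
  \int[m]_(x in Omega) X s x.1 x.2.

(** The right-hand side of the characteristic equation once the constant is taken out of the
    integral, see [flow_derive]. In this form the mean visibly cancels between two characteristics
    of one flow. *)
Definition flow_velocity (R : realType) (sigma p : R) (m : @planeProb R)
    (X : R -> R -> R -> R) (s y th : R) : R :=
  flow_mean m X s - X s y th + reaction sigma p th (X s y th).

(** The inequality [W1 m n <= W] for real [W], free of extended reals; see [W1_bound_leP]. *)
Definition W1_bound (R : realType) (m n : @planeProb R) (W : R) : Prop :=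
  forall f, lip1 f ->
    `|\int[m]_(x in Omega) f x - \int[n]_(x in Omega) f x| <= W.

Lemma W1_bound_sym (R : realType) (m n : @planeProb R) (W : R) :
  W1_bound m n W -> W1_bound n m W.
Proof. by move=> mnW f /mnW; rewrite distrC. Qed.

Lemma W1_bound_ge0 (R : realType) (m n : @planeProb R) (W : R) :
  W1_bound m n W -> 0 <= W.
Proof.
move=> mnW; apply: le_trans (normr_ge0 _) (mnW (cst 0) _) => x z _ _ /=.
by rewrite subrr normr0 plane_edist_ge0.
Qed.

(** [thmax^(1/p)] is the positive zero of the reaction term for [thmax]. The sum dominates both this
    equilibrium and every initial value. *)
Definition flow_max (R : realType) (p ymax thmax : R) : R :=
  ymax + thmax `^ p^-1.

(** The first term is the growth rate of a gap at equal [theta], the second accounts for a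
    difference in [theta] multiplied by a value of the flow, at most [flow_max]. *)
Definition flow_rate (R : realType) (sigma p ymax thmax : R) : R :=
  sigma * thmax + sigma * flow_max p ymax thmax.

(** * A priori bounds on one flow *)

Section flows.
Variables (R : realType) (sigma p T ymin ymax thmin thmax : R).
Hypotheses (sigma_gt0 : 0 < sigma) (p_gt0 : 0 < p).
Hypotheses (ymin_gt0 : 0 < ymin) (thmin_gt0 : 0 < thmin).
Hypotheses (ymin_le : ymin <= ymax) (thmin_le : thmin <= thmax).
Local Notation R0 := (rectangle ymin ymax thmin thmax).
Local Notation K := (flow_max p ymax thmax).
Local Notation a := (sigma * thmax).
Local Notation b := (flow_rate sigma p ymax thmax).
Local Notation c := (b + 2).

Let R0O : R0 `<=` Omega. Proof. exact: rectangle_Omega. Qed.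

Let ymax_ge0 : 0 <= ymax. Proof. exact: le_trans (ltW ymin_gt0) ymin_le. Qed.
Let thmax_ge0 : 0 <= thmax. Proof. exact: le_trans (ltW thmin_gt0) thmin_le. Qed.

Let K_ge0 : 0 <= K.
Proof. by rewrite addr_ge0 ?powR_ge0. Qed.

Let a_ge0 : 0 <= a. Proof. exact: mulr_ge0 (ltW _) _. Qed.

Let sK_ge0 : 0 <= sigma * K. Proof. exact: mulr_ge0 (ltW _) _. Qed.

Lemma negligible_setC_Omega (m : @planeProb R) :
  m (~` R0) = 0%E -> m (~` Omega) = 0%E.
Proof.
move=> m0; apply/eqP; rewrite -measure_le0 -m0; apply: le_measure.
- by rewrite inE; apply: measurableC; exact: measurable_Omega.
- by rewrite inE; apply: measurableC; exact: measurable_rectangle.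
- exact: subsetC.
Qed.

Section one_flow.
Variables (m : @planeProb R) (X : R -> R -> R -> R).
Hypotheses (m0 : m (~` R0) = 0%E) (flowX : integrable_flow sigma p T m X).

Local Notation velocityX := (flow_velocity sigma p m X).

Lemma flow_init (y th : R) : Omega (y, th) -> X 0 y th = y.
Proof. by case: flowX => ch _ _ /ch[]. Qed.

Lemma flow_gt0 (s y th : R) : Omega (y, th) -> 0 <= s < T -> 0 < X s y th.
Proof. by case: flowX => ch _ _ /ch[_ pos _ _]; exact: pos. Qed.

Lemma flow_continuous (t y th : R) : Omega (y, th) -> t < T ->
  {within `[0, t], continuous (fun s => X s y th)}.
Proof.
case: flowX => ch _ _ /ch[_ _ cX _] tT.
apply: continuous_subspaceW cX => s /=; rewrite !in_itv /= => /andP[-> st].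
exact: le_lt_trans tT.
Qed.

Lemma flow_derive (s y th : R) : Omega (y, th) -> 0 < s < T ->
  is_derive s (1 : R) (fun s => X s y th) (velocityX s y th).
Proof.
case: flowX => ch _ intX /[dup] Oyth /ch[_ _ _ dX] /[dup] sT /dX.
suff -> : \int[m]_(x in Omega) (X s x.1 x.2 - X s y th) =
    flow_mean m X s - X s y th by [].
have mO := @measurable_Omega R.
have {}sT : 0 <= s < T by case/andP: sT => /ltW -> ->.
rewrite RintegralB //; last exact: finite_measure_integrable_cst.
  rewrite Rintegral_cst // [X in fine X](_ : _ = 1%E) ?mulr1 //.
  exact: probability_concentrated (negligible_setC_Omega m0).
exact: intX.
Qed.

Lemma flow_le_corner (s y th : R) : R0 (y, th) -> 0 <= s < T ->
  X s y th <= X s ymax thmax.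
Proof.
move=> /[dup] /R0O Oyth [/= /andP[y1 y2] /andP[th1 th2]] /andP[s0 sT].
have Omax : Omega (ymax, thmax) by apply: R0O; split=> /=; rewrite ?lexx ?andbT.
suff : X s y th - X s ymax thmax <= 0 * expR (0 * s) by rewrite mul0r subr_le0.
(* The barrier is zero. Where the gap is positive, its derivative is at most [a] times the gap,
   since [th <= thmax] gives the remaining term of [reaction_diff_le] the right sign. *)
apply: (@exp_barrier _ (fun s => X s y th - X s ymax thmax)
  (fun s => velocityX s y th - velocityX s ymax thmax) s a 0 0) => //.
- move=> r; apply: (@continuousB R R^o (subspace `[0, s]));
    exact: flow_continuous.
- move=> r /andP[r0 rs].
  by apply: is_deriveB; apply: flow_derive => //; rewrite r0 (lt_trans rs).
- by rewrite !flow_init // subr_le0.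
- move=> r /andP[r0 rs]; rewrite mul0r subr_gt0 => /ltW gap.
  have rT : 0 <= r < T by apply/andP; split; lra.
  have v0 := flow_gt0 Omax rT.
  have := reaction_diff_le th thmax sigma_gt0 p_gt0 v0 gap.
  rewrite /flow_velocity mulr0 addr0.
  have : sigma * th * (X r y th - X r ymax thmax) <=
         sigma * thmax * (X r y th - X r ymax thmax).
    by rewrite ler_wpM2r ?subr_ge0 // ler_pM2l.
  have : sigma * (th - thmax) * X r ymax thmax <= 0.
    by rewrite -mulrA pmulr_rle0 // pmulr_lle0 //; lra.
  lra.
Qed.

(** It suffices to bound the corner characteristic. Above [K] it cannot increase: it dominates the
    mean by [flow_le_corner], and its reaction term is nonpositive because it exceeds
    [thmax^(1/p)]. *)
Lemma flow_le (s y th : R) : R0 (y, th) -> 0 <= s < T -> X s y th <= K.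
Proof.
move=> R0yth sT; apply: le_trans (flow_le_corner R0yth sT) _.
have {R0yth} R0max : R0 (ymax, thmax) by split=> /=; rewrite ?lexx ?andbT.
have Omax := R0O R0max; case/andP: sT => s0 sT.
suff : X s ymax thmax <= K * expR (0 * s) by rewrite mul0r expR0 mulr1.
apply: (@exp_barrier _ (fun s => X s ymax thmax)
  (fun s => velocityX s ymax thmax) s 0 0 K) => //.
- exact: flow_continuous.
- by move=> r /andP[r0 rs]; apply: flow_derive => //; rewrite r0 (lt_trans rs).
- by rewrite flow_init // /flow_max lerDl powR_ge0.
- move=> r /andP[r0 rs]; rewrite subrr !mul0r expR0 mulr1 addr0 => XK.
  have rT : 0 <= r < T by apply/andP; split; lra.
  have X0 := flow_gt0 Omax rT.
  have meanX : flow_mean m X r <= X r ymax thmax.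
    apply: le_trans (ler_norm _) _.
    apply: (normr_Rintegral_le_concentrated _ (measurable_rectangle _ _ _ _) m0) => //.
    - exact: measurable_Omega.
    - by case: flowX => _ mX _; exact: mX.
    - exact: ltW.
    - move=> [y' th'] Oyth R0yth; rewrite gtr0_norm; first exact: flow_le_corner.
      exact: flow_gt0.
  have thX : thmax <= X r ymax thmax `^ p.
    rewrite [leLHS](_ : thmax = (thmax `^ p^-1) `^ p); last first.
      by rewrite -powRrM mulVf ?gt_eqF // powRr1 //; lra.
    apply: ge0_ler_powR; rewrite ?nnegrE ?powR_ge0 ?(ltW p_gt0) ?(ltW X0) //.
    by apply: ltW; apply: le_lt_trans XK; rewrite /flow_max lerDr.
  have : reaction sigma p thmax (X r ymax thmax) <= 0.
    rewrite /reaction pmulr_rle0 ?subr_le0 //; exact: mulr_gt0.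
  by rewrite /flow_velocity; lra.
Qed.

Lemma flow_lipschitz_le (s : R) (x z : R * R) : R0 x -> R0 z -> 0 <= s < T ->
  X s x.1 x.2 - X s z.1 z.2 <= expR (b * s) * Defs.edist x z.
Proof.
move=> R0x R0z /andP[s0 sT].
have [Ox Oz] : Omega (x.1, x.2) /\ Omega (z.1, z.2).
  by rewrite -!surjective_pairing; split; exact: R0O.
rewrite mulrC; have e0 := plane_edist_ge0 x z.
apply: (@exp_barrier _ (fun s => X s x.1 x.2 - X s z.1 z.2)
  (fun s => velocityX s x.1 x.2 - velocityX s z.1 z.2) s b b) => //.
- move=> r; apply: (@continuousB R R^o (subspace `[0, s]));
    exact: flow_continuous.
- move=> r /andP[r0 rs].
  by apply: is_deriveB; apply: flow_derive => //; rewrite r0 (lt_trans rs).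
- rewrite !flow_init //; apply: le_trans (ler_norm _) _.
  exact: normr_fst_le_edist.
- move=> r /andP[r0 rs]; rewrite subrr mul0r addr0 => gap.
  have rT : 0 <= r < T by apply/andP; split; lra.
  have v0 := flow_gt0 Oz rT.
  have br : 1 <= expR (b * r).
    by rewrite -expR0 ler_expR mulr_ge0 //; rewrite /flow_rate ?addr_ge0 //; lra.
  (* Above the barrier the gap exceeds the initial distance, in particular the difference in
     [theta]. The inhomogeneous term is thus at most [sigma * K] times the gap, and the inequality
     becomes linear with rate [b]. *)
  have egap : Defs.edist x z <= X r x.1 x.2 - X r z.1 z.2.
    apply: le_trans (ltW gap); exact: ler_peMr.
  have vu : X r z.1 z.2 <= X r x.1 x.2 by lra.
  have := reaction_diff_le x.2 z.2 sigma_gt0 p_gt0 v0 vu.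
  rewrite /flow_velocity /flow_rate.
  case: R0x => _ /andP[_ x2].
  have : sigma * x.2 * (X r x.1 x.2 - X r z.1 z.2) <=
         sigma * thmax * (X r x.1 x.2 - X r z.1 z.2).
    by rewrite ler_wpM2r ?subr_ge0 // ler_pM2l.
  have : sigma * (x.2 - z.2) * X r z.1 z.2 <=
         sigma * K * (X r x.1 x.2 - X r z.1 z.2).
    rewrite -!mulrA ler_pM2l // mulrC.
    apply: (@le_trans _ _ (K * `|x.2 - z.2|)).
      apply: le_trans (ler_wpM2l (ltW v0) (ler_norm _)) _.
      apply: ler_wpM2r => //; apply: flow_le rT.
      by rewrite -surjective_pairing.
    by apply: ler_wpM2l => //; apply: le_trans egap; exact: normr_snd_le_edist.
  lra.
Qed.

Lemma flow_lipschitz (s : R) (x z : R * R) : R0 x -> R0 z -> 0 <= s < T ->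
  `|X s x.1 x.2 - X s z.1 z.2| <= expR (b * s) * Defs.edist x z.
Proof.
move=> R0x R0z sT; rewrite ler_norml flow_lipschitz_le // andbT lerNl opprB.
rewrite (_ : Defs.edist x z = Defs.edist z x); first exact: flow_lipschitz_le.
by rewrite /Defs.edist; congr Num.sqrt; ring.
Qed.

End one_flow.

(** * Comparison of two flows *)

Lemma flow_mean_diff (m n : @planeProb R) (X Z : R -> R -> R -> R)
    (W A s : R) :
  m (~` R0) = 0%E -> n (~` R0) = 0%E ->
  integrable_flow sigma p T m X -> integrable_flow sigma p T n Z ->
  W1_bound m n W -> 0 <= s < T ->
  (forall x, R0 x -> `|X s x.1 x.2 - Z s x.1 x.2| <= A) ->
  `|flow_mean m X s - flow_mean n Z s| <= expR (b * s) * W + A.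
Proof.
move=> m0 n0 flowX flowZ mnW sT XZA.
have mO := @measurable_Omega R.
have mR0 : measurable R0 by exact: measurable_rectangle.
have [_ mX _] := flowX; have [_ mZ intZ] := flowZ.
have A0 : 0 <= A.
  have R0max : R0 (ymax, thmax) by split=> /=; rewrite ?lexx ?andbT.
  exact: le_trans (normr_ge0 _) (XZA _ R0max).
have XK x : Omega x -> R0 x -> `|X s x.1 x.2| <= K.
  case: x => y th Oyth R0yth.
  by rewrite gtr0_norm; [exact: (flow_le m0 flowX)|exact: (flow_gt0 flowX)].
(* [X] is the flow of [m], but its pointwise bound on the rectangle makes it integrable for [n] too.
   The difference of means then splits into [X] against [m - n] and [X - Z] against [n]. *)
have intX := bounded_integrable_concentrated mO mR0 n0 (mX s sT) XK.
rewrite -(subrK (flow_mean n X s) (flow_mean m X s)) -addrA.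
apply: le_trans (ler_normD _ _) _; apply: lerD.
  apply: (lipschitz_Rintegral_diff ymin_gt0 thmin_gt0 ymin_le thmin_le) => //.
  - exact: mX.
  - exact: expR_gt0.
  - by move=> x z R0x R0z; exact: (flow_lipschitz m0 flowX).
rewrite /flow_mean -RintegralB //; last exact: intZ.
apply: (normr_Rintegral_le_concentrated mO mR0 n0) => //.
- by apply: measurable_funB; [exact: mX|exact: mZ].
- by move=> x _; exact: XZA.
Qed.

(** The difference of means acts as a forcing of size at most [(W + A) exp (c r)]. A barrier growing
    at rate [c], with [c - a >= 2], absorbs a forcing of twice its height, hence the factor one
    half. *)
Lemma flow_gap_improve_le (m n : @planeProb R) (X Z : R -> R -> R -> R)
    (W A t y th : R) :
  m (~` R0) = 0%E -> n (~` R0) = 0%E ->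
  integrable_flow sigma p T m X -> integrable_flow sigma p T n Z ->
  W1_bound m n W -> 0 <= t < T -> 0 <= A ->
  (forall s x, 0 <= s <= t -> R0 x ->
     `|X s x.1 x.2 - Z s x.1 x.2| <= A * expR (c * s)) ->
  R0 (y, th) -> X t y th - Z t y th <= (W + A) / 2 * expR (c * t).
Proof.
move=> m0 n0 flowX flowZ mnW /andP[t0 tT] A0 gapA R0yth.
have Oyth := R0O R0yth; have W0 := W1_bound_ge0 mnW.
apply: (@exp_barrier _ (fun s => X s y th - Z s y th)
  (fun s => flow_velocity sigma p m X s y th - flow_velocity sigma p n Z s y th)
  t a c) => //.
- move=> r; apply: (@continuousB R R^o (subspace `[0, t])).
    exact: (flow_continuous flowX).
  exact: (flow_continuous flowZ).
- move=> r /andP[r0 rt]; have rT : 0 < r < T by rewrite r0 (lt_trans rt).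
  apply: is_deriveB; first exact: (flow_derive m0 flowX).
  exact: (flow_derive n0 flowZ).
- rewrite (flow_init flowX) // (flow_init flowZ) // subrr.
  by rewrite divr_ge0 ?addr_ge0.
- move=> r /andP[r0 rt] gap.
  have rT : 0 <= r < T by apply/andP; split; lra.
  have c0 : 0 <= c by rewrite /flow_rate !addr_ge0.
  have bc : expR (b * r) <= expR (c * r).
    by rewrite ler_expR ler_wpM2r ?(ltW r0) // lerDl.
  have v0 := flow_gt0 flowZ Oyth rT.
  have vu : Z r y th <= X r y th.
    rewrite -subr_ge0; apply: le_trans (ltW gap).
    by rewrite mulr_ge0 ?expR_ge0 // divr_ge0 ?addr_ge0.
  have := reaction_diff_le th th sigma_gt0 p_gt0 v0 vu.
  have rt' : 0 <= r <= t by rewrite !ltW.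
  have := flow_mean_diff m0 n0 flowX flowZ mnW rT (fun x => gapA r x rt').
  move/(le_trans (ler_norm _)).
  have : expR (b * r) * W <= expR (c * r) * W by exact: ler_wpM2r.
  have : sigma * th * (X r y th - Z r y th) <= a * (X r y th - Z r y th).
    by case: R0yth => _ /= /andP[_ ?]; rewrite ler_wpM2r ?subr_ge0 // ler_pM2l.
  have : 2 * ((W + A) / 2 * expR (c * r)) <=
         (c - a) * ((W + A) / 2 * expR (c * r)).
    apply: ler_wpM2r.
      by rewrite mulr_ge0 ?expR_ge0 // divr_ge0 ?addr_ge0.
    by move: sK_ge0; rewrite /flow_rate; lra.
  rewrite /flow_velocity subrr mulr0 mul0r addr0.
  have -> : 2 * ((W + A) / 2 * expR (c * r)) =
    expR (c * r) * W + A * expR (c * r).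
    by field.
  lra.
Qed.

Lemma flow_gap_improve (m n : @planeProb R) (X Z : R -> R -> R -> R)
    (W A t : R) :
  m (~` R0) = 0%E -> n (~` R0) = 0%E ->
  integrable_flow sigma p T m X -> integrable_flow sigma p T n Z ->
  W1_bound m n W -> t < T -> 0 <= A ->
  (forall s x, 0 <= s <= t -> R0 x ->
     `|X s x.1 x.2 - Z s x.1 x.2| <= A * expR (c * s)) ->
  (forall s x, 0 <= s <= t -> R0 x ->
     `|X s x.1 x.2 - Z s x.1 x.2| <= (W + A) / 2 * expR (c * s)).
Proof.
move=> m0 n0 flowX flowZ mnW tT A0 gapA s [y th] /andP[s0 st] R0x /=.
have sT : 0 <= s < T by rewrite s0 (le_lt_trans st).
have gapAs r x : 0 <= r <= s -> R0 x ->
    `|X r x.1 x.2 - Z r x.1 x.2| <= A * expR (c * r).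
  by move=> /andP[r0 rs]; apply: gapA; rewrite r0 (le_trans rs).
rewrite ler_norml lerNl opprB; apply/andP; split.
  apply: (flow_gap_improve_le n0 m0 flowZ flowX (W1_bound_sym mnW)) => //.
  by move=> r x rs R0x'; rewrite distrC; exact: gapAs.
exact: (flow_gap_improve_le m0 n0 flowX flowZ mnW).
Qed.

(** The least admissible constant [D] is the supremum of the gaps divided by [exp (c s)]. The
    improvement step gives [D <= (W + D) / 2], that is [D <= W]. *)
Lemma flow_gap (m n : @planeProb R) (X Z : R -> R -> R -> R)
    (W t : R) (x : R * R) :
  m (~` R0) = 0%E -> n (~` R0) = 0%E ->
  integrable_flow sigma p T m X -> integrable_flow sigma p T n Z ->
  W1_bound m n W -> 0 <= t < T -> R0 x ->
  `|X t x.1 x.2 - Z t x.1 x.2| <= W * expR (c * t).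
Proof.
move=> m0 n0 flowX flowZ mnW /andP[t0 tT] R0x.
pose gaps := [set r | exists s z, [/\ 0 <= s <= t, R0 z &
  r = `|X s z.1 z.2 - Z s z.1 z.2| / expR (c * s)]].
(* Both flows take values between 0 and [K], so the supremum is finite; without this the improvement
   would prove nothing. *)
have gaps_ub : ubound gaps K.
  move=> _ [s [[y th] [/andP[s0 st] R0z ->]]] /=.
  have sT : 0 <= s < T by rewrite s0 (le_lt_trans st).
  have XK := flow_le m0 flowX R0z sT; have ZK := flow_le n0 flowZ R0z sT.
  have X0 := flow_gt0 flowX (R0O R0z) sT.
  have Z0 := flow_gt0 flowZ (R0O R0z) sT.
  rewrite ler_pdivrMr ?expR_gt0 //.
  apply: (@le_trans _ _ K); first by rewrite ler_norml; apply/andP; split; lra.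
  apply: ler_peMr => //; rewrite -expR0 ler_expR mulr_ge0 //.
  by rewrite /flow_rate !addr_ge0.
have gapsx : gaps (`|X t x.1 x.2 - Z t x.1 x.2| / expR (c * t)).
  by exists t, x; rewrite lexx t0.
have gaps_sup : has_sup gaps by split; [eexists; exact: gapsx|exists K].
pose D := sup gaps.
have D0 : 0 <= D.
  apply: le_trans (sup_upper_bound gaps_sup gapsx).
  by rewrite divr_ge0 ?expR_ge0.
have gapD s z : 0 <= s <= t -> R0 z ->
    `|X s z.1 z.2 - Z s z.1 z.2| <= D * expR (c * s).
  move=> st R0z; rewrite -ler_pdivrMr ?expR_gt0 //.
  by apply: (sup_upper_bound gaps_sup); exists s, z.
have gapD' := flow_gap_improve m0 n0 flowX flowZ mnW tT D0 gapD.
have DW : D <= W.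
  suff : D <= (W + D) / 2 by lra.
  apply: ge_sup; first by case: gaps_sup.
  move=> _ [s [z [st R0z ->]]]; rewrite ler_pdivrMr ?expR_gt0 //.
  exact: gapD'.
apply: le_trans (gapD t x _ R0x) _; first by rewrite t0 lexx.
by rewrite ler_wpM2r ?expR_ge0.
Qed.

Lemma flow_comp_integrable (m n : @planeProb R) (X : R -> R -> R -> R)
    (f : R * R -> R) (s : R) :
  m (~` R0) = 0%E -> n (~` R0) = 0%E -> integrable_flow sigma p T m X ->
  0 <= s < T -> lip1 f ->
  n.-integrable Omega (fun x => (f (X s x.1 x.2, x.2))%:E).
Proof.
move=> m0 n0 flowX sT lipf; have [_ mX _] := flowX.
(* The Lipschitz bound from the corner: [K + ymax] bounds the distance in [y], both values being
   nonnegative, and [thmax] the distance in [theta]. *)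
pose B := `|f (ymax, thmax)| + ((K + ymax) + thmax).
apply: (bounded_integrable_concentrated _ _ n0 (B := B)).
- exact: measurable_Omega.
- exact: measurable_rectangle.
- apply: (@measurable_comp_shear _ (fun x => X s x.1 x.2)).
  + by move=> [y th] Oyth; exact: (flow_gt0 flowX).
  + exact: mX.
  + exact: lip1_measurable.
- move=> [y th] Oyth R0yth /=.
  have Omax : Omega (ymax, thmax) by apply: R0O; split=> /=; rewrite ?lexx ?andbT.
  have X0 := flow_gt0 flowX Oyth sT; have XK := flow_le m0 flowX R0yth sT.
  have OX : Omega (X s y th, th) by case: Oyth.
  have := lipf _ _ OX Omax.
  move/le_trans => /(_ _ (plane_edist_le_normr _ _)) /= fB.
  rewrite -[f _ in leLHS](subrK (f (ymax, thmax))).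
  apply: le_trans (ler_normD _ _) _; rewrite addrC /B lerD2l.
  apply: le_trans fB _; case: R0yth => _ /= /andP[th1 th2].
  have th0 : 0 < th by case: Oyth.
  apply: lerD; rewrite ler_norml; apply/andP; split;
    move: ymax_ge0 thmax_ge0; lra.
Qed.

(** The constant 3 is 2 + 1: at most [2 exp (b t) W] for [f] along [X] against [m - n], and at most
    [exp (c t) W] for the gap between the two flows, with [b <= c]. *)
Lemma flow_W1_bound (m n : @planeProb R) (mu nu : R -> @planeProb R)
    (X Z : R -> R -> R -> R) (W t : R) :
  m (~` R0) = 0%E -> n (~` R0) = 0%E ->
  integrable_flow sigma p T m X -> integrable_flow sigma p T n Z ->
  transported T m mu X -> transported T n nu Z ->
  0 <= t < T -> W1_bound m n W ->
  W1_bound (mu t) (nu t) (3 * expR (c * t) * W).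
Proof.
move=> m0 n0 flowX flowZ trX trZ tT mnW f lipf.
have mO := @measurable_Omega R.
have mR0 : measurable R0 by exact: measurable_rectangle.
have X0 x : Omega x -> 0 < X t x.1 x.2.
  by case: x => y th Oyth; exact: (flow_gt0 flowX).
have Z0 x : Omega x -> 0 < Z t x.1 x.2.
  by case: x => y th Oyth; exact: (flow_gt0 flowZ).
have mf := lip1_measurable lipf.
rewrite (Rintegral_transported (negligible_setC_Omega m0) trX) //; last first.
  exact: (flow_comp_integrable m0 m0 flowX).
rewrite (Rintegral_transported (negligible_setC_Omega n0) trZ) //; last first.
  exact: (flow_comp_integrable n0 n0 flowZ).
set fX := fun x : R * R => f (X t x.1 x.2, x.2).
set fZ := fun x : R * R => f (Z t x.1 x.2, x.2).
have mfX : measurable_fun Omega fX.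
  by apply: (@measurable_comp_shear _ (fun x => X t x.1 x.2)) => //;
    case: flowX => _ mX _; exact: mX.
have mfZ : measurable_fun Omega fZ.
  by apply: (@measurable_comp_shear _ (fun x => Z t x.1 x.2)) => //;
    case: flowZ => _ mZ _; exact: mZ.
have intX : n.-integrable Omega (EFin \o fX).
  exact: (flow_comp_integrable m0 n0 flowX).
have intZ : n.-integrable Omega (EFin \o fZ).
  exact: (flow_comp_integrable n0 n0 flowZ).
have t0 : 0 <= t by case/andP: tT.
have b0 : 0 <= b by rewrite /flow_rate addr_ge0.
have W0 := W1_bound_ge0 mnW.
have shearO (g : R * R -> R) x : (forall x, Omega x -> 0 < g x) -> R0 x ->
    Omega (g x, x.2).
  by move=> g0 /R0O Ox; split; [exact: g0|case: Ox].
(* One [exp (b t)] comes from the flow, the other from the [theta] coordinate, which does not move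
   and has Lipschitz constant [1 <= exp (b t)]. *)
have lipfX x z : R0 x -> R0 z ->
    `|fX x - fX z| <= 2 * expR (b * t) * Defs.edist x z.
  move=> R0x R0z.
  apply: le_trans (lipf _ _ (shearO _ x X0 R0x) (shearO _ z X0 R0z)) _.
  apply: le_trans (plane_edist_le_normr _ _) _ => /=.
  have := flow_lipschitz m0 flowX R0x R0z tT.
  have := normr_snd_le_edist x z.
  have : Defs.edist x z <= expR (b * t) * Defs.edist x z.
    apply: ler_peMl; first exact: plane_edist_ge0.
    by rewrite -expR0 ler_expR mulr_ge0.
  lra.
have XZ_close x : Omega x -> R0 x -> `|fX x - fZ x| <= W * expR (c * t).
  move=> _ R0x.
  apply: le_trans (lipf _ _ (shearO _ x X0 R0x) (shearO _ x Z0 R0x)) _.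
  apply: le_trans (plane_edist_le_normr _ _) _ => /=.
  by rewrite subrr normr0 addr0; exact: (flow_gap m0 n0).
have := lipschitz_Rintegral_diff ymin_gt0 thmin_gt0 ymin_le thmin_le m0 n0 mnW
  mfX (mulr_gt0 (ltr0Sn R 1) (expR_gt0 _)) lipfX.
have : `|\int[n]_(x in Omega) (fX x - fZ x)| <= W * expR (c * t).
  apply: (normr_Rintegral_le_concentrated mO mR0 n0) => //.
  - exact: measurable_funB.
  - by rewrite mulr_ge0 ?expR_ge0.
rewrite RintegralB // => near_int lip_int.
rewrite -(subrK (\int[n]_(x in Omega) fX x) (\int[m]_(x in Omega) fX x)).
rewrite -addrA; apply: le_trans (ler_normD _ _) _.
have : expR (b * t) * W <= expR (c * t) * W.
  by rewrite ler_wpM2r // ler_expR ler_wpM2r // lerDl.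
lra.
Qed.

End flows.

(** * From solutions to the Wasserstein estimate *)

Lemma mv_solution_flow (R : realType) (sigma p T : R) (mu0 : @planeProb R)
    (mu : R -> @planeProb R) :
  mu0 (~` Omega) = 0%E -> mv_solution sigma p T mu0 mu ->
  exists2 X, integrable_flow sigma p T mu0 X & transported T mu0 mu X.
Proof.
move=> Om0 [P0mu _ _ [X chX trX]]; exists X => //; split=> // s sT.
  by case: (trX s sT).
exact: (transported_integrable Om0 trX sT (P0mu s sT)).
Qed.

Lemma W1_bound_leP (R : realType) (m n : @planeProb R) (W : R) :
  (W1 m n <= W%:E)%E <-> W1_bound m n W.
Proof.
split=> [mnW f lipf|mnW].
  by rewrite -lee_fin; apply: le_trans mnW; apply: ereal_sup_ubound; exists f.
by apply: ge_ereal_sup => _ [f /= lipf <-]; rewrite lee_fin; exact: mnW.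
Qed.

Lemma W1_ge0 (R : realType) (m n : @planeProb R) : (0 <= W1 m n)%E.
Proof.
apply: (@le_trans _ _ (`|\int[m]_(x in Omega) (cst 0 : R * R -> R) x -
  \int[n]_(x in Omega) (cst 0 : R * R -> R) x|)%:E).
  by rewrite lee_fin.
apply: ereal_sup_ubound; exists (cst 0) => // x z _ _ /=.
by rewrite subrr normr0 plane_edist_ge0.
Qed.

Theorem lemma2p4 (R : realType) (sigma p : R)
    (sigma_gt0 : 0 < sigma) (p_gt0 : 0 < p)
    (ymin ymax thmin thmax : R) (ymin_gt0 : 0 < ymin) (thmin_gt0 : 0 < thmin) :
  exists C c : R, [/\ 0 < C, 0 < c &
    forall (mu0 nu0 : @planeProb R) (mu nu : R -> @planeProb R),
      P0 mu0 -> P0 nu0 ->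
      msupport mu0 `<=` rectangle ymin ymax thmin thmax ->
      msupport nu0 `<=` rectangle ymin ymax thmin thmax ->
      global_mv_solution sigma p mu0 mu ->
      global_mv_solution sigma p nu0 nu ->
      forall t : R, 0 < t ->
        (W1 (mu t) (nu t) <= (C * expR (c * t))%:E * W1 mu0 nu0)%E].
Proof.
have cR := @closed_rectangle R ymin ymax thmin thmax.
have [/andP[ymin_le thmin_le]|empty] :=
    boolP ((ymin <= ymax) && (thmin <= thmax)); last first.
  (* An empty rectangle supports no probability measure, so any positive constants do. *)
  exists 1, 1; split=> // mu0 nu0 mu nu _ _ supp0.
  have R00 : rectangle ymin ymax thmin thmax = set0.
    rewrite -subset0 => x [/andP[y1 y2] /andP[th1 th2]].
    by move/negP: empty; apply; rewrite (le_trans y1) ?(le_trans th1).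
  have := negligible_setC_msupport cR supp0.
  by rewrite R00 setC0 probability_setT => /eqP; rewrite eqe oner_eq0.
have c_gt0 : 0 < flow_rate sigma p ymax thmax + 2.
  apply: ltr_wpDl => //; rewrite /flow_rate /flow_max.
  rewrite addr_ge0 ?mulr_ge0 ?addr_ge0 ?powR_ge0 ?(ltW sigma_gt0) //; lra.
exists 3, (flow_rate sigma p ymax thmax + 2); split=> //.
move=> mu0 nu0 mu nu _ _ supp_mu supp_nu sol_mu sol_nu t t_gt0.
have mu00 := negligible_setC_msupport cR supp_mu.
have nu00 := negligible_setC_msupport cR supp_nu.
(* Any horizon beyond [t] will do: the constants are already fixed and do not depend on it. *)
have tT : 0 <= t < t + 1 by rewrite ltW //= ltrDl.
have T_gt0 : 0 < t + 1 by rewrite addr_gt0.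
have O0 (m : @planeProb R) : m (~` rectangle ymin ymax thmin thmax) = 0%E ->
    m (~` Omega) = 0%E by exact: (negligible_setC_Omega ymin_gt0 thmin_gt0).
have [X flowX trX] := mv_solution_flow (O0 _ mu00) (sol_mu _ T_gt0).
have [Z flowZ trZ] := mv_solution_flow (O0 _ nu00) (sol_nu _ T_gt0).
(* The value [-oo] is excluded by nonnegativity; for [+oo] the right-hand side is infinite because
   its factor is positive. *)
have := W1_ge0 mu0 nu0; case W1E : (W1 mu0 nu0) => [W| |] // _.
  rewrite -EFinM; apply/W1_bound_leP.
  have mnW : W1_bound mu0 nu0 W by apply/W1_bound_leP; rewrite W1E.
  exact: (flow_W1_bound sigma_gt0 p_gt0 ymin_gt0 thmin_gt0 ymin_le thmin_le
            mu00 nu00 flowX flowZ trX trZ tT mnW).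
by rewrite gt0_muley ?leey // lte_fin mulr_gt0 ?expR_gt0.
Qed.
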